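(* Let $(X,\tau)$ be a topological space. If $(X,\tau)$ is connected, then $(X,\tau,\mathfrak{a})$ is $\mathfrak{a}$-connected for every scope function $\mathfrak{a}$ on $(X,\tau)$.
   Context: A scope function on a topological space $(X,\tau)$ is a function $\mathfrak{a}:X\to\tau$ such that $x\in\mathfrak{a}(x)$ for every $x\in X$; the triple $(X,\tau,\mathfrak{a})$ is then called an $\mathfrak{a}$-space. A subset $A\subseteq X$ is $\mathfrak{a}$-open if $\mathfrak{a}(x)\subseteq A$ for every $x\in A$; the collection $\tau_{\mathfrak{a}}$ of all $\mathfrak{a}$-open sets is a topology on $X$ with $\tau_{\mathfrak{a}}\subseteq\tau$. The space $(X,\tau,\mathfrak{a})$ is $\mathfrak{a}$-disconnected if there exist nonempty disjoint $U,V\in\tau_{\mathfrak{a}}$ with $X=U\cup V$, and $\mathfrak{a}$-connected if it is not $\mathfrak{a}$-disconnected. *)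

(* Defs.v *)
From HB Require Import structures.
From mathcomp Require Import all_boot all_order all_algebra.
From mathcomp Require Import all_classical topology.

Set Implicit Arguments.
Unset Strict Implicit.
Unset Printing Implicit Defensive.

Local Open Scope classical_set_scope.

Record scope_function (X : topologicalType) := ScopeFunction {
  scope_set :> X -> set X;
  scope_set_open : forall x : X, open (scope_set x);
  scope_set_self : forall x : X, scope_set x x
}.

Definition scope_open (X : topologicalType) (a : scope_function X)
    (A : set X) : Prop :=
  forall x : X, A x -> a x `<=` A.

Definition scope_topology (X : topologicalType) (a : scope_function X) :
    set (set X) :=
  [set A | scope_open a A].

Definition scope_disconnected (X : topologicalType) (a : scope_function X) :
    Prop :=
  exists U V : set X,
    [/\ scope_topology a U, scope_topology a V, U !=set0, V !=set0
      & U `&` V = set0 /\ [set: X] = U `|` V].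

Definition scope_connected (X : topologicalType) (a : scope_function X) :
    Prop :=
  ~ scope_disconnected a.

(* Main.v *)
Require Import Defs.
From HB Require Import structures.
From mathcomp Require Import all_boot all_order all_algebra.
From mathcomp Require Import all_classical topology.

Local Open Scope classical_set_scope.

(** Since [scope_open] sets are open, a separation by them is an ordinary one: [U] is nonempty and
    clopen, hence the whole space, leaving no point for [V]. *)

(** Around each of its points [x], [A] contains the open neighbourhood [a x]. *)
Lemma open_scope_open (X : topologicalType) (a : scope_function X)
    (A : set X) : scope_open a A -> open A.
Proof.
move=> aA; rewrite openE => x Ax; rewrite /interior.
apply: (filterS (aA x Ax)); apply: open_nbhs_nbhs.
by split; [exact: scope_set_open | exact: scope_set_self].
Qed.

Theorem theorem4p2 (X : topologicalType) (connX : connected [set: X])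
    (a : scope_function X) : scope_connected a.
Proof.
move=> [U [V [aU aV U0 [v Vv] [UV0 UVT]]]].
have UE : U = ~` V.
  apply/seteqP; split=> x; first by move=> Ux Vx; rewrite -[False]/(set0 x) -UV0.
  by move=> nVx; have : [set: X] x by []; rewrite UVT => -[].
have UT : U = [set: X].
  (* [U] itself is both the open and the closed set whose trace [connected] asks for; it is closed
     as the complement of the open [V]. *)
  apply: connX => //.
    by exists U; rewrite ?setTI//; exact: open_scope_open aU.
  exists U; rewrite ?setTI// UE closedC; exact: open_scope_open aV.
by have : U v; [rewrite UT | rewrite UE; exact].
Qed.
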